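(* For all non-decreasing functions $f:\mathbb{R}\to\mathbb{R}$ with $f(x)-f(x-1)\le 1/(10\sqrt2)$ for all $x\in\mathbb{R}$, it holds $$\mathrm{Ent}_\tau(e^f)\le2740\int_{\mathbb{R}}\left(f(x)-f(x-1)\right)^2e^{f(x)}\,\tau(dx)$$ and $$\mathrm{Ent}_\tau(e^f)\le2740\int_{\mathbb{R}}\left(f(x+1)-f(x)\right)^2e^{f(x)}\,\tau(dx).$$
   Context: $\tau$ is the symmetric exponential probability measure on $\mathbb{R}$, $\tau(dx)=\frac12e^{-|x|}dx$. Entropy: $\mathrm{Ent}_\tau(e^f)=\int fe^f\,d\tau-\left(\int e^f\,d\tau\right)\log\left(\int e^f\,d\tau\right)$. *)

(* Defs.v *)
From HB Require Import structures.
From mathcomp Require Import all_boot all_order all_algebra.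
From mathcomp Require Import all_classical all_reals all_analysis.
From mathcomp Require Import measurable_realfun.
Set Implicit Arguments.
Unset Strict Implicit.
Unset Printing Implicit Defensive.
Import Order.TTheory GRing.Theory Num.Theory.
Import numFieldNormedType.Exports.

Local Open Scope classical_set_scope.
Local Open Scope ring_scope.

Section symexp.
Context {R : realType}.
Notation mu := (@lebesgue_measure R).

Definition symexp_pdf (x : R) : R := 2^-1 * expR (- `|x|).

Lemma symexp_pdf_ge0 x : 0 <= symexp_pdf x.
Proof. by rewrite mulr_ge0 ?invr_ge0 ?expR_ge0. Qed.

Lemma continuous_symexp_pdf : continuous symexp_pdf.
Proof.
move=> x; apply: (@continuousM _ R^o (fun=> 2^-1) (fun x => expR (- `|x|))).
  exact: cst_continuous.
apply: continuous_comp; last exact: continuous_expR.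
by apply: (@continuousN _ R^o); exact: norm_continuous.
Qed.

Lemma measurable_symexp_pdf : measurable_fun [set: R] symexp_pdf.
Proof. by apply: continuous_measurable_fun; exact: continuous_symexp_pdf. Qed.

Lemma integral_symexp_pdf : (\int[mu]_x (symexp_pdf x)%:E = 1)%E.
Proof.
have symN : symexp_pdf =1 symexp_pdf \o -%R.
  by move=> x; rewrite /symexp_pdf /= normrN.
rewrite (ge0_symfun_integralT symexp_pdf_ge0 continuous_symexp_pdf);
  last exact: symN.
have -> : (\int[mu]_(x in [set x | (0 <= x)%R]) (symexp_pdf x)%:E =
    2^-1%:E * \int[mu]_(x in `[0%R, +oo[) (exponential_pdf 1 x)%:E)%E.
  rewrite -ge0_integralZl//=; last 2 first.
  - apply/measurable_funTS/measurableT_comp => //.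
    exact: measurable_exponential_pdf.
  - by move=> x _; rewrite lee_fin exponential_pdf_ge0.
  rewrite set_itvE; apply: eq_integral => x; rewrite inE/= => x0.
  by rewrite exponential_pdfE// mul1r mulN1r /symexp_pdf ger0_norm.
have -> : (\int[mu]_(x in `[0%R, +oo[) (exponential_pdf 1 x)%:E = 1)%E.
  rewrite -(@integral_exponential_pdf R 1)// [LHS]integral_mkcond.
  apply: eq_integral => x _; rewrite patchE; case: ifPn => // x0.
  by rewrite /exponential_pdf patchE (negbTE x0).
by rewrite mule1 -EFinM divff.
Qed.

Definition symexp_prob (V : set R) : \bar R :=
  (\int[mu]_(x in V) (symexp_pdf x)%:E)%E.

Let symexp0 : symexp_prob set0 = 0%E.
Proof. by rewrite /symexp_prob integral_set0. Qed.

Let symexp_ge0 A : (0 <= symexp_prob A)%E.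
Proof. by apply: integral_ge0 => x _; rewrite lee_fin symexp_pdf_ge0. Qed.

Let symexp_sigma_additive : semi_sigma_additive symexp_prob.
Proof.
move=> /= F mF tF mUF; rewrite /symexp_prob; apply: cvg_toP.
  apply: ereal_nondecreasing_is_cvgn => m n mn.
  apply: lee_sum_nneg_natr => // k _ _; apply: integral_ge0 => /= x Fkx.
  by rewrite lee_fin symexp_pdf_ge0.
rewrite ge0_integral_bigcup//=.
- apply/measurable_funTS/measurableT_comp => //.
  exact: measurable_symexp_pdf.
- by move=> x _; rewrite lee_fin symexp_pdf_ge0.
Qed.

HB.instance Definition _ := isMeasure.Build _ _ _
  symexp_prob symexp0 symexp_ge0 symexp_sigma_additive.

Let symexp_setT : symexp_prob [set: R] = 1%E.
Proof. exact: integral_symexp_pdf. Qed.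

HB.instance Definition _ :=
  @Measure_isProbability.Build _ _ R symexp_prob symexp_setT.

End symexp.

(* The entropy Ent_P(e^f), as an extended real; it has its usual meaning when
   e^f and f e^f are P-integrable. *)
Definition entropy_expR d (T : measurableType d) (R : realType)
    (P : probability T R) (f : T -> R) : \bar R :=
  (\int[P]_x (f x * expR (f x))%:E
   - (\int[P]_x (expR (f x))%:E) * lne (\int[P]_x (expR (f x))%:E))%E.

(* Main.v *)
Require Import Defs.
From HB Require Import structures.
From mathcomp Require Import all_boot all_order all_algebra.
From mathcomp Require Import all_classical all_reals all_analysis.
From mathcomp Require Import measurable_realfun ring lra.
Import Order.TTheory GRing.Theory Num.Theory.
Import numFieldNormedType.Exports.
Local Open Scope classical_set_scope.
Local Open Scope ring_scope.

(** Subtract the constant f 0, so that h := f - f 0 vanishes at 0 and has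
    increments at most 1/10 over unit steps.  Since z ln z >= a z + z - e^a for
    every real a (convexity), choosing a := f 0 bounds the entropy by
    e^(f 0) times the integral of phi(h), where phi(t) := t e^t - e^t + 1
    ([entropy_expR_le]).  Moreover phi(t) <= (t^+)^2 e^t + (t^-)^2
    ([entropy_function_le]), so the right and left half-lines are treated
    separately.

    On each half-line the estimate is a discrete Hardy inequality obtained by
    absorption.  Put v := (h^+)^2 e^h.  Moving one step to the left costs
      v(x) <= theta v(x - 1) + C (h(x) - h(x - 1))^2 e^(h(x)), theta < 2,
    ([pos_deviation_step]).  Since v lives on the positive half-line, where the
    density of tau loses a factor e > 2 at each unit step, the integral of
    v(x - 1) is at most half that of v, and the first term on the right is
    absorbed in the left-hand side ([pos_deviation_integral_le]).  The function
    w := (h^-)^2 satisfies the mirror estimate on the negative half-line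
    ([neg_deviation_step], [neg_deviation_integral_le]); there the missing
    weight e^h is recovered because the error term is needed only where h is
    bounded below: once h <= -2, one step changes w by a factor close to 1.

    This bounds the entropy by a combination of the backward and the forward
    energies.  A unit translation changes the density of tau by a factor at
    most e, so these two energies control each other ([forward_le_backward],
    [backward_le_forward]) and either of them suffices.

    Absorption requires finite integrals: |h(x)| <= (|x| + 1)/10, so every
    integrand is dominated by a multiple of e^(|x|/2). *)

(** * Translations and densities *)

Lemma measurable_fun_shift (R : realType) (g : R -> R) (a : R) :
  measurable_fun [set: R] g -> measurable_fun [set: R] (fun x => g (x + a)).
Proof. by move=> mg; apply: measurableT_comp => //; exact: measurable_funD. Qed.

Lemma lebesgue_measure_shift (R : realType) (a : R) (A : set R) :
  measurable A ->
  pushforward (@lebesgue_measure R)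
    ((fun x => x + a)%R : measurableTypeR R -> measurableTypeR R) A
  = lebesgue_measure A.
Proof.
move=> mA.
have ms : measurable_fun [set: measurableTypeR R]
    ((fun x => x + a)%R : measurableTypeR R -> measurableTypeR R).
  exact: (measurable_fun_shift _ id).
pose phi := HB.pack_for {mfun measurableTypeR R >-> measurableTypeR R}
  ((fun x => x + a)%R : measurableTypeR R -> measurableTypeR R)
  (isMeasurableFun.Build _ _ _ _ _ ms).
apply/esym.
apply: (@lebesgue_measure_unique R (pushforward lebesgue_measure phi)) => //.
move=> _ [[u v]] _ <-.
transitivity (lebesgue_measure `](u - a), (v - a)]%classic).
  rewrite !lebesgue_measure_itv/= !lte_fin ltrD2r.
  by case: ifPn => // _; rewrite -!EFinB; congr EFin; lra.
congr lebesgue_measure; apply/seteqP.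
by split => x /=; rewrite !in_itv/= ltrBlDr lerBrDr.
Qed.

Lemma ge0_integral_shift (R : realType) (a : R) (k : R -> \bar R) :
  measurable_fun [set: R] k -> (forall x, 0 <= k x)%E ->
  (\int[@lebesgue_measure R]_x k (x + a)%R = \int[lebesgue_measure]_x k x)%E.
Proof.
move=> mk k0.
have ms : measurable_fun [set: measurableTypeR R]
    ((fun x => x + a)%R : measurableTypeR R -> measurableTypeR R).
  exact: (measurable_fun_shift _ id).
transitivity (\int[pushforward (@lebesgue_measure R)
    ((fun x => x + a)%R : measurableTypeR R -> measurableTypeR R)]_x k x)%E.
  by rewrite ge0_integral_pushforward.
by apply: eq_measure_integral => A mA _; exact: lebesgue_measure_shift.
Qed.

(** The Radon-Nikodym derivative of P with respect to mu is almost everywhere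
    equal to p, because both have the same integral over every measurable
    set. *)
Lemma ge0_integral_density d (T : measurableType d) (R : realType)
    (mu : {sigma_finite_measure set T -> \bar R}) (P : probability T R)
    (p : T -> R) (k : T -> \bar R) :
  measurable_fun [set: T] p -> (forall x, 0 <= p x) ->
  (forall A, measurable A -> P A = \int[mu]_(x in A) (p x)%:E)%E ->
  measurable_fun [set: T] k -> (forall x, 0 <= k x)%E ->
  (\int[P]_x k x = \int[mu]_x (k x * (p x)%:E))%E.
Proof.
move=> mp p0 Pp mk k0.
have PM : P `<< mu.
  apply/null_content_dominatesP => A mA muA.
  apply: (eq_trans (Pp A mA)); apply: null_set_integral => //.
  by apply/measurable_funTS; exact/measurable_EFinP.
rewrite -(Radon_Nikodym_SigmaFinite.change_of_variables PM)//.
have iq := Radon_Nikodym_SigmaFinite.f_integrable PM.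
apply: ae_eq_integral => //.
- by apply: emeasurable_funM => //; exact: (measurable_int _ iq).
- by apply: emeasurable_funM => //; exact/measurable_EFinP.
apply: ae_eqe_mul2l; apply: integral_ae_eq => //.
- exact/measurable_EFinP.
- move=> A _ mA; rewrite -Radon_Nikodym_SigmaFinite.f_integral//; exact: Pp.
Qed.

(** * The symmetric exponential measure *)

Section symexp.
Context {R : realType}.
Implicit Types a x y : R.

Lemma symexp_prob_integral (k : R -> R) :
  measurable_fun [set: R] k -> (forall x, 0 <= k x) ->
  (\int[@symexp_prob R]_x (k x)%:E =
   \int[@lebesgue_measure R]_x (k x * symexp_pdf x)%:E)%E.
Proof.
move=> mk k0.
have mEk : measurable_fun [set: R] (EFin \o k) by exact/measurable_EFinP.
(* [symexp_prob] lives on [R] and [lebesgue_measure] on [measurableTypeR R]: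
   the same sigma-algebra with two different displays, so the probability is
   first pushed forward along the identity. *)
have mid : measurable_fun [set: R] (idfun : R -> measurableTypeR R).
  exact: (@measurable_id _ _ setT).
pose idRT := HB.pack_for {mfun R >-> measurableTypeR R}
  (idfun : R -> measurableTypeR R) (isMeasurableFun.Build _ _ _ _ _ mid).
rewrite -(@ge0_integral_density _ _ _ (@lebesgue_measure R)
  (distribution (@symexp_prob R) idRT) (@symexp_pdf R) (EFin \o k))//.
- rewrite ge0_integral_pushforward; [|exact: mid| |exact: mEk|] => //.
  by move=> x _; rewrite lee_fin.
- exact: measurable_symexp_pdf.
- exact: symexp_pdf_ge0.
Qed.

(** Translating the variable by a makes the density be evaluated at x - a,
    and the comparison of densities only matters where k does not vanish.  For
    a function supported on a half-line a unit shift can be a contraction; for a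
    general one it costs a factor e. *)
Lemma symexp_prob_shift_le (C a : R) (k : R -> R) : 0 <= C ->
  measurable_fun [set: R] k -> (forall x, 0 <= k x) ->
  (forall x, k x != 0 -> symexp_pdf (x - a) <= C * symexp_pdf x) ->
  (\int[@symexp_prob R]_x (k (x + a)%R)%:E <=
   C%:E * \int[@symexp_prob R]_x (k x)%:E)%E.
Proof.
move=> C0 mk k0 Ck.
have p0 := @symexp_pdf_ge0 R.
have mka : measurable_fun [set: R] (fun x => k (x + a)).
  exact: measurable_fun_shift.
have mp : measurable_fun [set: R] (@symexp_pdf R) := measurable_symexp_pdf.
have mpa : measurable_fun [set: R] (fun x => symexp_pdf (x - a)).
  exact: measurable_fun_shift.
have mkp : measurable_fun [set: R] (fun x => (k x * symexp_pdf x)%:E).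
  by apply/measurable_EFinP; exact: measurable_funM.
have mkpa : measurable_fun [set: R] (fun x => (k x * symexp_pdf (x - a))%:E).
  by apply/measurable_EFinP; exact: measurable_funM.
have kp0 x y : (0 <= (k x * symexp_pdf y)%:E)%E by rewrite lee_fin mulr_ge0.
rewrite !symexp_prob_integral//.
have -> : (\int[@lebesgue_measure R]_x (k (x + a) * symexp_pdf x)%R%:E =
    \int[@lebesgue_measure R]_x (k x * symexp_pdf (x - a))%R%:E)%E.
  rewrite -(@ge0_integral_shift _ a (fun x => (k x * symexp_pdf (x - a))%:E))//.
  by apply: eq_integral => x _; rewrite addrK.
rewrite -ge0_integralZl//.
apply: ge0_le_integral => //.
  exact: measurable_funeM.
move=> x _; rewrite -EFinM lee_fin; have [->|kx] := eqVneq (k x) 0.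
  by rewrite !mul0r mulr0.
by rewrite [leRHS]mulrCA ler_wpM2l// Ck.
Qed.

Lemma expRN1_le2V : expR (-1) <= 2^-1 :> R.
Proof.
by rewrite expRN lef_pV2 ?posrE ?expR_gt0// (le_trans _ (expR_ge1Dx 1)).
Qed.

Lemma symexp_pdf_outward a x : `|x - a| = `|x| + 1 ->
  symexp_pdf (x - a) <= 2^-1 * symexp_pdf x.
Proof.
move=> xa; rewrite /symexp_pdf xa opprD expRD [leRHS]mulrCA ler_wpM2l//.
by rewrite mulrC ler_wpM2r ?expR_ge0// expRN1_le2V.
Qed.

Lemma expR1_le4 : expR 1 <= 4 :> R.
Proof.
have h : 2^-1 <= expR (- 2^-1) :> R.
  by rewrite (le_trans _ (expR_ge1Dx _))//; lra.
have e2 : expR 2^-1 <= 2 :> R.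
  by move: h; rewrite expRN lef_pV2 ?posrE ?expR_gt0.
have -> : expR 1 = expR 2^-1 * expR 2^-1 :> R.
  by rewrite -expRD; congr expR; lra.
by have := ler_pM (expR_ge0 _) (expR_ge0 _) e2 e2; lra.
Qed.

Lemma symexp_pdf_shift a x : `|a| <= 1 ->
  symexp_pdf (x - a) <= 4 * symexp_pdf x.
Proof.
move=> a1; rewrite /symexp_pdf mulrCA ler_wpM2l//.
rewrite (le_trans _ (ler_wpM2r (expR_ge0 _) expR1_le4))// -expRD ler_expR.
by have := ler_normD (x - a) a; rewrite subrK; lra.
Qed.

(** Up to normalization the integrand e^(|x|/2) e^(-|x|) is, on the positive
    half-line, the density of the exponential distribution of rate 1/2. *)
Lemma symexp_integral_expR_half :
  (\int[@symexp_prob R]_x (expR (`|x| / 2)%R)%:E < +oo)%E.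
Proof.
pose q x : R := 2^-1 * expR (- (`|x| / 2)).
have cn : continuous (fun x : R => `|x| / 2).
  move=> x; apply: continuousM; first exact: norm_continuous.
  exact: cst_continuous.
have mn : measurable_fun [set: R] (fun x : R => `|x| / 2).
  exact: continuous_measurable_fun.
rewrite symexp_prob_integral; last 2 first.
- exact: measurableT_comp.
- by move=> x; exact: expR_ge0.
have -> : (\int[@lebesgue_measure R]_x
    (expR (`|x| / 2) * symexp_pdf x)%R%:E =
    \int[@lebesgue_measure R]_x (q x)%:E)%E.
  apply: eq_integral => x _; congr EFin.
  by rewrite /symexp_pdf /q mulrCA -expRD; congr (_ * expR _); lra.
rewrite ge0_symfun_integralT; last 3 first.
- by move=> x; rewrite mulr_ge0 ?expR_ge0.
- move=> x; apply: (@continuousM _ R^o (fun=> 2^-1)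
    (fun x => expR (- (`|x| / 2)))); first exact: cst_continuous.
  apply: continuous_comp; last exact: continuous_expR.
  by apply: (@continuousN _ R^o); exact: cn.
- by move=> x; rewrite /q /= normrN.
have -> : (\int[@lebesgue_measure R]_(x in [set x | (0 <= x)%R]) (q x)%:E =
    \int[@lebesgue_measure R]_(x in `[0%R, +oo[) (exponential_pdf 2^-1 x)%:E)%E.
  rewrite set_itvE; apply: eq_integral => x; rewrite inE/= => x0.
  by rewrite exponential_pdfE// /q ger0_norm//; congr ((_ * expR _)%:E); lra.
rewrite lte_mul_pinfty//.
apply: (@le_lt_trans _ _
    (\int[@lebesgue_measure R]_x (exponential_pdf 2^-1 x)%:E)%E).
  apply: ge0_subset_integral => //=.
  - by apply/measurable_EFinP; exact: measurable_exponential_pdf.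
  - by move=> x _; rewrite lee_fin exponential_pdf_ge0.
by rewrite integral_exponential_pdf// ltry.
Qed.

Lemma symexp_integrable (K : R) (g : R -> R) : measurable_fun [set: R] g ->
  (forall x, `|g x| <= K * expR (`|x| / 2)) ->
  (@symexp_prob R).-integrable [set: R] (EFin \o g).
Proof.
move=> mg gK.
have mn : measurable_fun [set: R] (fun x : R => expR (`|x| / 2)).
  by apply: measurableT_comp => //; exact: measurable_funM.
apply: (@le_integrable _ _ _ _ _ _ _
    (fun x => K%:E * (expR (`|x| / 2)%R)%:E)%E) => //.
- exact/measurable_EFinP.
- by move=> x _ /=; rewrite lee_fin (le_trans (gK x)) ?ler_norm.
apply: integrableZl => //; apply/integrableP; split.
  exact/measurable_EFinP.
under eq_integral do rewrite /= ger0_norm ?expR_ge0//.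
exact: symexp_integral_expR_half.
Qed.

End symexp.

(** * Absorption *)

(** Integrating v <= th vs + g gives V <= th q V + G, and the term th q V can
    be moved to the left-hand side because V is finite and
    th q <= 1 - 1 / L < 1. *)
Lemma ge0_integral_le_of_contraction d (T : measurableType d) (R : realType)
    (P : probability T R) (v vs g : T -> R) (th q L : R) :
  0 <= th -> 0 <= q -> 0 < L -> th * q + L^-1 <= 1 ->
  P.-integrable [set: T] (EFin \o v) ->
  measurable_fun [set: T] vs -> measurable_fun [set: T] g ->
  (forall x, 0 <= v x) -> (forall x, 0 <= vs x) -> (forall x, 0 <= g x) ->
  (forall x, v x <= th * vs x + g x) ->
  (\int[P]_x (vs x)%:E <= q%:E * \int[P]_x (v x)%:E)%E ->
  (\int[P]_x (v x)%:E <= L%:E * \int[P]_x (g x)%:E)%E.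
Proof.
move=> th0 q0 L0 thL iv mvs mg v0 vs0 g0 vle vsle.
have mv : measurable_fun [set: T] v.
  by apply/measurable_EFinP; exact: measurable_int iv.
have mvE : measurable_fun [set: T] (EFin \o v) by exact/measurable_EFinP.
have mvsE : measurable_fun [set: T] (EFin \o vs) by exact/measurable_EFinP.
have mgE : measurable_fun [set: T] (EFin \o g) by exact/measurable_EFinP.
have g0E x : (0 <= (g x)%:E)%E by rewrite lee_fin.
have vs0E x : (0 <= (vs x)%:E)%E by rewrite lee_fin.
have : (\int[P]_x (v x)%:E <=
    th%:E * \int[P]_x (vs x)%:E + \int[P]_x (g x)%:E)%E.
  rewrite -ge0_integralZl// -ge0_integralD//.
  - apply: ge0_le_integral => //.
    + by move=> x _; rewrite lee_fin.
    + by apply: emeasurable_funD => //; exact: measurable_funeM.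
    + by move=> x _; rewrite -EFinM -EFinD lee_fin.
  - by move=> x _; rewrite mule_ge0 ?lee_fin.
  - exact: measurable_funeM.
have vfin := integrable_fin_num measurableT iv.
have V0 : (0 <= \int[P]_x (v x)%:E)%E.
  by apply: integral_ge0 => x _; rewrite lee_fin.
have G0 : (0 <= \int[P]_x (g x)%:E)%E by exact: integral_ge0.
move: vsle V0 G0; rewrite -(fineK vfin).
set V : R := fine _.
have S0 : (0 <= \int[P]_x (vs x)%:E)%E by exact: integral_ge0.
move: S0.
case: (\int[P]_x (vs x)%:E)%E => [S S0| //|//].
case: (\int[P]_x (g x)%:E)%E => [G| _ _ _|//].
  rewrite -!EFinM -EFinD !lee_fin => h1 V0 G0 h2.
  rewrite -ler_pdivrMl//.
  have : L^-1 * V + th * q * V <= V.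
    by rewrite -mulrDl addrC ler_piMl.
  by have := ler_wpM2l th0 h2; nra.
by rewrite gt0_muley ?leey// lte_fin.
Qed.

(** * A variational bound for the entropy *)

Lemma entropy_function_ge0 (R : realType) (h : R) :
  0 <= h * expR h - expR h + 1.
Proof.
have := expR_ge1Dx (- h); rewrite expRN => /(ler_wpM2r (expR_ge0 h)).
by rewrite mulVf ?gt_eqF ?expR_gt0//; lra.
Qed.

(** The exponential weight is present for h >= 0 only: for h -> - oo the
    left-hand side tends to 1, so no multiple of h ^+ 2 * expR h bounds it. *)
Lemma entropy_function_le (R : realType) (h : R) : h * expR h - expR h + 1 <=
  Num.max h 0 ^+ 2 * expR h + Num.max (- h) 0 ^+ 2.
Proof.
have e0 := expR_gt0 h.
have /orP[h0|h0] := le_total 0 h.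
  rewrite (@max_l _ _ h)// (@max_r _ _ (-h)); last lra.
  have : expR (- h) <= 1 - h + h ^+ 2.
    have h1 : (1 + h) * expR (- h) <= 1.
      by rewrite expRN ler_pdivrMr// mul1r expR_ge1Dx.
    have h2 : 0 <= h ^+ 3 by rewrite exprn_ge0.
    rewrite -(@ler_pM2l _ (1 + h)); last lra.
    rewrite (le_trans h1)// -subr_ge0.
    by have -> : (1 + h) * (1 - h + h ^+ 2) - 1 = h ^+ 3 by ring.
  move=> /(ler_wpM2l (ltW e0)); rewrite expRN mulfV ?gt_eqF//.
  by nra.
rewrite (@max_r _ _ h)// (@max_l _ _ (- h)); last lra.
have := expR_ge1Dx h => /(@ler_wpM2r _ (1 - h)) -/(_ ltac:(lra)).
by nra.
Qed.

(** Legendre duality between z ln z - z and the exponential, that is,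
    e^y >= 1 + y at y := a - ln z. *)
Lemma xlnx_ge (R : realType) (a z : R) : 0 < z ->
  a * z + z - expR a <= z * ln z.
Proof.
move=> z0; have := expR_ge1Dx (a - ln z).
rewrite expRD expRN lnK ?posrE// => /(ler_wpM2l (ltW z0)).
rewrite [X in _ <= X](_ : _ = expR a); first by nra.
by rewrite mulrCA mulfV ?gt_eqF// mulr1.
Qed.

(** Linearizing z ln z at z := expR a makes the bound an integral of a
    nonnegative function; a is free, to be chosen close to f. *)
Lemma entropy_expR_le d (T : measurableType d) (R : realType)
    (P : probability T R) (f : T -> R) (a : R) :
  P.-integrable [set: T] (EFin \o (fun x => expR (f x))) ->
  P.-integrable [set: T] (EFin \o (fun x => f x * expR (f x))) ->
  (entropy_expR P f <= \int[P]_x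
     (expR a * ((f x - a) * expR (f x - a) - expR (f x - a) + 1))%:E)%E.
Proof.
move=> i1 i2.
pose Z : R := fine (\int[P]_x (expR (f x))%:E)%E.
have ZE : (\int[P]_x (expR (f x))%:E = Z%:E)%E.
  by rewrite fineK//; exact: integrable_fin_num i1.
pose W : R := fine (\int[P]_x (f x * expR (f x))%:E)%E.
have WE : (\int[P]_x (f x * expR (f x))%:E = W%:E)%E.
  by rewrite fineK//; exact: integrable_fin_num i2.
have Z0 : 0 < Z.
  rewrite lt_neqAle fine_ge0 ?integral_ge0// andbT.
    apply/eqP => Z0; have : (\int[P]_x `|(expR (f x))%:E| = 0)%E.
      under eq_integral do rewrite gee0_abs ?lee_fin ?expR_ge0//.
      by rewrite ZE -Z0.
    have mf : measurable_fun [set: T] (fun x => (expR (f x))%:E).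
      exact: measurable_int i1.
    move=> /(ae_eq_integral_abs _ measurableT mf) [N [mN N0 sN]].
    suff : P [set: T] = 0%E.
      by rewrite probability_setT => /eqP; rewrite onee_eq0.
    suff -> : [set: T] = N by [].
    apply/esym/seteqP; split => // x _; apply: sN => /= /(_ I) [].
    by apply/eqP; rewrite gt_eqF ?expR_gt0.
rewrite /entropy_expR ZE WE lne_EFin//.
rewrite [leRHS](_ : _ = \int[P]_x ((f x * expR (f x))%:E -
   ((a + 1)%:E * (expR (f x))%:E - (expR a)%:E)))%E; last first.
  apply: eq_integral => x _; rewrite -!EFinM -!EFinB; congr EFin.
  by rewrite expRB; field; rewrite gt_eqF ?expR_gt0.
have i0 : P.-integrable [set: T] (cst (expR a)%:E).
  exact: finite_measure_integrable_cst.
have i3 : P.-integrable [set: T] (fun x => (a + 1)%:E * (expR (f x))%:E)%E.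
  exact: integrableZl.
rewrite integralB//; last exact: integrableB.
rewrite integralB// integralZl// integral_cst//= probability_setT mule1 ZE WE.
rewrite -!EFinM -!EFinB lee_fin; have := xlnx_ge _ a Z Z0; nra.
Qed.


(** * Monotone functions with small unit increments *)

Section increments.
Context {R : realType} (h : R -> R).

Definition backward_energy (x : R) : R := (h x - h (x - 1)) ^+ 2 * expR (h x).
Definition forward_energy (x : R) : R := (h (x + 1) - h x) ^+ 2 * expR (h x).
Definition pos_deviation (x : R) : R := Num.max (h x) 0 ^+ 2 * expR (h x).
Definition neg_deviation (x : R) : R := Num.max (- h x) 0 ^+ 2.

Hypothesis h_nd : {homo h : x y / x <= y}.
Hypothesis h0 : h 0 = 0.
Hypothesis h_step : forall x, h x - h (x - 1) <= 10^-1.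

Let h_back x : h (x - 1) <= h x.
Proof. by apply: h_nd; lra. Qed.

Let h_fore x : h x <= h (x + 1).
Proof. by apply: h_nd; lra. Qed.

Let h_step1 x : h (x + 1) - h x <= 10^-1.
Proof. by have := h_step (x + 1); rewrite addrK. Qed.

Lemma normr_le_of_step x : `|h x| <= (`|x| + 1) / 10.
Proof.
have up n y : y <= n%:R -> h y <= n%:R / 10.
  elim: n y => [|n IHn] y yn; first by rewrite mul0r -h0 h_nd.
  have := h_step y; have := IHn (y - 1); rewrite -natr1 in yn *.
  by move=> /(_ ltac:(lra)); lra.
have lo n y : - n%:R <= y -> - (n%:R / 10) <= h y.
  elim: n y => [|n IHn] y yn.
    by rewrite mul0r oppr0 -h0 h_nd// -oppr0.
  have := h_step1 y; have := IHn (y + 1); rewrite -natr1 in yn *.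
  by move=> /(_ ltac:(lra)); lra.
have /andP[n1 n2] := truncn_itv (normr_ge0 x).
set n := (Num.truncn `|x|).+1 in n2.
have nx : n%:R <= `|x| + 1 by rewrite /n -natr1 lerD2r.
have [x1 x2] : - n%:R <= x /\ x <= n%:R.
  by apply/andP; rewrite -ler_norml ltW.
by rewrite ler_norml; apply/andP; have := up _ _ x2; have := lo _ _ x1; lra.
Qed.

Lemma expR_step x : expR (h x) <= 10 / 9 * expR (h (x - 1)).
Proof.
have := expR_ge1Dx (h (x - 1) - h x).
rewrite expRB ler_pdivlMr ?expR_gt0//.
have := expR_gt0 (h x); have := h_step x; nra.
Qed.

(** The square grows by (a + b)^2 <= (5/4) a^2 + 5 b^2 and the exponential by a
    factor at most 10/9; their product 25/18 is below 2, hence below the factor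
    e lost by the density. *)
Lemma pos_deviation_step x :
  pos_deviation x <= 25 / 18 * pos_deviation (x - 1) + 5 * backward_energy x.
Proof.
rewrite /pos_deviation /backward_energy.
set m := Num.max (h x) 0; set m1 := Num.max (h (x - 1)) 0.
have m10 : 0 <= m1 by rewrite le_max lexx orbT.
have m0 : 0 <= m by rewrite le_max lexx orbT.
have mm : m <= m1 + (h x - h (x - 1)).
  have hm1 : h (x - 1) <= m1 by rewrite le_max lexx.
  by rewrite ge_max; apply/andP; have := h_back x; lra.
have sq : m ^+ 2 <= 5 / 4 * m1 ^+ 2 + 5 * (h x - h (x - 1)) ^+ 2.
  rewrite (@le_trans _ _ ((m1 + (h x - h (x - 1))) ^+ 2))//.
    by rewrite ler_sqr ?nnegrE ?(le_trans m0).
  rewrite -subr_ge0; set D := h x - _.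
  have -> : 5 / 4 * m1 ^+ 2 + 5 * D ^+ 2 - (m1 + D) ^+ 2 =
    (m1 / 2 - 2 * D) ^+ 2 by field.
  exact: sqr_ge0.
have := ler_wpM2r (expR_ge0 (h x)) sq; move=> /le_trans; apply.
have : 5 / 4 * m1 ^+ 2 * expR (h x) <=
    5 / 4 * m1 ^+ 2 * (10 / 9 * expR (h (x - 1))).
  by rewrite ler_wpM2l ?expR_step// mulr_ge0 ?sqr_ge0//; lra.
by move=> e; lra.
Qed.

(** The error 5 (h(x + 1) - h(x))^2 has to be charged to [forward_energy], which
    carries the weight e^(h(x)).  If h(x) <= -2 then the increment is at most a
    tenth of h^-(x + 1), and (11/10)^2 <= 5/4 makes the error unnecessary;
    otherwise 1 <= 16 e^(h(x)), whence the constant 80. *)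
Lemma neg_deviation_step x :
  neg_deviation x <= 5 / 4 * neg_deviation (x + 1) + 80 * forward_energy x.
Proof.
rewrite /neg_deviation /forward_energy.
set m := Num.max (- h x) 0; set m1 := Num.max (- h (x + 1)) 0.
have m10 : 0 <= m1 by rewrite le_max lexx orbT.
have m0 : 0 <= m by rewrite le_max lexx orbT.
have D0 := h_fore x; have D1 := h_step1 x.
have mm : m <= m1 + (h (x + 1) - h x).
  have hm1 : - h (x + 1) <= m1 by rewrite le_max lexx.
  by rewrite ge_max; apply/andP; lra.
have m2 : m ^+ 2 <= (m1 + (h (x + 1) - h x)) ^+ 2.
  by rewrite ler_sqr ?nnegrE ?(le_trans m0).
apply: (le_trans m2); move: mm m2 D0 D1.
set D := h (x + 1) - h x => mm m2 D0 D1.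
have Dge : 0 <= D by rewrite subr_ge0.
have e0 := expR_gt0 (h x).
have [hx|hx] := leP (h x) (- 2).
  have m19 : 1 <= m1.
    have : - h (x + 1) <= m1 by rewrite le_max lexx.
    by move: D1; rewrite /D; lra.
  have : 0 <= 80 * (D ^+ 2 * expR (h x)).
    by rewrite !mulr_ge0// ?sqr_ge0 ?expR_ge0.
  have : D <= m1 / 10 by lra.
  by nra.
have e16 : 1 <= 16 * expR (h x).
  have e2 : expR (- 2) <= expR (h x) by rewrite ler_expR ltW.
  have e4 : expR 1 * expR 1 <= 16 :> R.
    have e4 := @expR1_le4 R.
    by have := ler_pM (expR_ge0 1) (expR_ge0 1) e4 e4; lra.
  have e1 : expR 1 * expR 1 * expR (- 2) = 1 :> R.
    by rewrite -!expRD (_ : 1 + 1 - 2 = 0) ?expR0//; lra.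
  by rewrite -[leLHS]e1 ler_pM ?mulr_ge0 ?expR_ge0.
have : D ^+ 2 <= D ^+ 2 * (16 * expR (h x)) by rewrite ler_peMr ?sqr_ge0.
have : 0 <= (m1 / 2 - 2 * D) ^+ 2 by exact: sqr_ge0.
by move=> ? ?; nra.
Qed.

Let mh : measurable_fun [set: R] h.
Proof. exact: nondecreasing_measurable. Qed.

Let measurable_backward_energy : measurable_fun [set: R] backward_energy.
Proof.
apply: measurable_funM; last exact: measurableT_comp.
apply: measurable_funX; apply: measurable_funB => //.
exact: measurable_fun_shift.
Qed.

Let measurable_forward_energy : measurable_fun [set: R] forward_energy.
Proof.
apply: measurable_funM; last exact: measurableT_comp.
apply: measurable_funX; apply: measurable_funB => //.
exact: measurable_fun_shift.
Qed.

Let measurable_pos_deviation : measurable_fun [set: R] pos_deviation.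
Proof.
apply: measurable_funM; last exact: measurableT_comp.
by apply: measurable_funX; exact: measurable_maxr.
Qed.

Let measurable_neg_deviation : measurable_fun [set: R] neg_deviation.
Proof.
apply: measurable_funX; apply: measurable_maxr => //.
exact: measurableT_comp.
Qed.

Lemma expR3_normr_le x : expR (3 * `|h x|) <= 2 * expR (`|x| / 2).
Proof.
have e3 : expR (3 / 10) <= 2 :> R.
  have : 2^-1 <= expR (- (3 / 10)) :> R.
    by rewrite (le_trans _ (expR_ge1Dx _))//; lra.
  by rewrite expRN lef_pV2 ?posrE ?expR_gt0.
rewrite (le_trans _ (ler_wpM2r (expR_ge0 _) e3))// -expRD ler_expR.
by have := normr_le_of_step x; have := normr_ge0 x; lra.
Qed.

(** The exponent 3 leaves room for e^h times a polynomial of degree 2 in h. *)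
Lemma symexp_integrable_of_step (K : R) (g : R -> R) : 0 <= K ->
  measurable_fun [set: R] g -> (forall x, `|g x| <= K * expR (3 * `|h x|)) ->
  (@symexp_prob R).-integrable [set: R] (EFin \o g).
Proof.
move=> K0 mg gK; apply: (@symexp_integrable _ (K * 2)) => // x.
by rewrite (le_trans (gK x))// -mulrA ler_wpM2l// expR3_normr_le.
Qed.

Let sqr_le_expR (y t : R) : 0 <= y -> y <= t -> y ^+ 2 <= expR (2 * t).
Proof.
move=> y0 yt; rewrite mulrC expRM_natr ler_sqr ?nnegrE ?expR_ge0//.
by rewrite (le_trans yt)// (le_trans _ (expR_ge1Dx _))//; lra.
Qed.

Let integrable_pos_deviation :
  (@symexp_prob R).-integrable [set: R] (EFin \o pos_deviation).
Proof.
apply: (@symexp_integrable_of_step 1) => // x.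
have nh : h x <= `|h x| by exact: ler_norm.
have m0 : 0 <= Num.max (h x) 0 by rewrite le_max lexx orbT.
rewrite mul1r ger0_norm ?mulr_ge0 ?sqr_ge0 ?expR_ge0//.
rewrite (_ : 3 * _ = 2 * `|h x| + `|h x|); last lra.
rewrite expRD ler_pM ?sqr_ge0 ?expR_ge0 ?ler_expR//.
by apply: sqr_le_expR => //; rewrite ge_max nh normr_ge0.
Qed.

Let integrable_neg_deviation :
  (@symexp_prob R).-integrable [set: R] (EFin \o neg_deviation).
Proof.
apply: (@symexp_integrable_of_step 1) => // x.
have nh : - h x <= `|h x| by rewrite -normrN ler_norm.
have m0 : 0 <= Num.max (- h x) 0 by rewrite le_max lexx orbT.
rewrite mul1r ger0_norm ?sqr_ge0//.
rewrite (@le_trans _ _ (expR (2 * `|h x|)))//.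
  by apply: sqr_le_expR => //; rewrite ge_max nh normr_ge0.
by rewrite ler_expR ler_wpM2r//; lra.
Qed.

Let pos_deviation_ge0 x : 0 <= pos_deviation x.
Proof. by rewrite mulr_ge0 ?sqr_ge0 ?expR_ge0. Qed.

Let neg_deviation_ge0 x : 0 <= neg_deviation x.
Proof. exact: sqr_ge0. Qed.

Let backward_energy_ge0 x : 0 <= backward_energy x.
Proof. by rewrite mulr_ge0 ?sqr_ge0 ?expR_ge0. Qed.

Let forward_energy_ge0 x : 0 <= forward_energy x.
Proof. by rewrite mulr_ge0 ?sqr_ge0 ?expR_ge0. Qed.

(** By monotonicity [pos_deviation] vanishes on the negative half-line, so
    shifting it to the right halves its integral. *)
Lemma pos_deviation_integral_le :
  (\int[@symexp_prob R]_x (pos_deviation x)%:E <=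
  20%:E * \int[@symexp_prob R]_x (backward_energy x)%:E)%E.
Proof.
have -> : (20%:E = 4%:E * 5%:E :> \bar R)%E.
  by rewrite -EFinM; congr EFin; lra.
rewrite -muleA -ge0_integralZl//; last 2 first.
- exact/measurable_EFinP.
- by move=> x _; rewrite lee_fin.
apply: (@ge0_integral_le_of_contraction _ _ _ _ pos_deviation
  (fun x => pos_deviation (x - 1)) (fun x => 5 * backward_energy x)
  (25 / 18) 2^-1) => //.
- by lra.
- exact: measurable_fun_shift.
- exact: measurable_funM.
- by move=> x; rewrite mulr_ge0.
- exact: pos_deviation_step.
apply: symexp_prob_shift_le => //.
move=> x px; apply: symexp_pdf_outward.
have x0 : 0 <= x.
  rewrite leNgt; apply: contra px => /ltW /h_nd; rewrite h0 => hx.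
  by rewrite /pos_deviation max_r// expr0n mul0r.
by rewrite !ger0_norm; lra.
Qed.

Lemma neg_deviation_integral_le :
  (\int[@symexp_prob R]_x (neg_deviation x)%:E <=
  320%:E * \int[@symexp_prob R]_x (forward_energy x)%:E)%E.
Proof.
have -> : (320%:E = 4%:E * 80%:E :> \bar R)%E.
  by rewrite -EFinM; congr EFin; lra.
rewrite -muleA -ge0_integralZl//; last 2 first.
- exact/measurable_EFinP.
- by move=> x _; rewrite lee_fin.
apply: (@ge0_integral_le_of_contraction _ _ _ _ neg_deviation
  (fun x => neg_deviation (x + 1)) (fun x => 80 * forward_energy x)
  (5 / 4) 2^-1) => //.
- by lra.
- exact: measurable_fun_shift.
- exact: measurable_funM.
- by move=> x; rewrite mulr_ge0.
- exact: neg_deviation_step.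
apply: symexp_prob_shift_le => //.
move=> x px; apply: symexp_pdf_outward.
have x0 : x <= 0.
  rewrite leNgt; apply: contra px => /ltW /h_nd; rewrite h0 => hx.
  by rewrite /neg_deviation max_r ?oppr_le0// expr0n.
by rewrite !ler0_norm; lra.
Qed.

(** The forward energy at x is a shift of the backward one, except that the
    exponential weight is taken at the lower endpoint of the step, which favours
    this direction and costs the factor of [expR_step] in the other one. *)
Lemma forward_le_backward : (\int[@symexp_prob R]_x (forward_energy x)%:E <=
  4%:E * \int[@symexp_prob R]_x (backward_energy x)%:E)%E.
Proof.
apply: (@le_trans _ _
    (\int[@symexp_prob R]_x (backward_energy (x + 1)%R)%:E)%E).
  apply: ge0_le_integral => //.
  - by move=> x _; rewrite lee_fin.
  - exact/measurable_EFinP.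
  - by apply/measurable_EFinP; exact: measurable_fun_shift.
  - move=> x _; rewrite lee_fin /forward_energy /backward_energy addrK.
    by rewrite ler_wpM2l ?sqr_ge0// ler_expR.
apply: symexp_prob_shift_le => // x _.
by apply: symexp_pdf_shift; rewrite normr1.
Qed.

Lemma backward_le_forward : (\int[@symexp_prob R]_x (backward_energy x)%:E <=
  5%:E * \int[@symexp_prob R]_x (forward_energy x)%:E)%E.
Proof.
apply: (@le_trans _ _ ((10 / 9)%:E *
    \int[@symexp_prob R]_x (forward_energy (x - 1)%R)%:E)%E).
  rewrite -ge0_integralZl//; last 2 first.
  - by apply/measurable_EFinP; exact: measurable_fun_shift.
  - by move=> x _; rewrite lee_fin.
  apply: ge0_le_integral => //.
  - by move=> x _; rewrite lee_fin.
  - exact/measurable_EFinP.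
  - apply: measurable_funeM; apply/measurable_EFinP.
    exact: measurable_fun_shift.
  - move=> x _; rewrite -EFinM lee_fin /forward_energy /backward_energy subrK.
    by rewrite mulrCA ler_wpM2l ?sqr_ge0// expR_step.
apply: (@le_trans _ _ ((10 / 9)%:E * (4%:E *
    \int[@symexp_prob R]_x (forward_energy x)%:E))%E).
  rewrite lee_wpmul2l ?lee_fin//.
  apply: symexp_prob_shift_le => // x _.
  by apply: symexp_pdf_shift; rewrite normrN normr1.
rewrite muleA -EFinM lee_wpmul2r//.
  by apply: integral_ge0 => x _; rewrite lee_fin.
by rewrite lee_fin; lra.
Qed.

Lemma entropy_function_integral_le : (\int[@symexp_prob R]_x
    (h x * expR (h x) - expR (h x) + 1)%:E <=
  20%:E * \int[@symexp_prob R]_x (backward_energy x)%:E +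
  320%:E * \int[@symexp_prob R]_x (forward_energy x)%:E)%E.
Proof.
apply: le_trans (leeD pos_deviation_integral_le neg_deviation_integral_le).
rewrite -ge0_integralD//; last 4 first.
- by move=> x _; rewrite lee_fin.
- exact/measurable_EFinP.
- by move=> x _; rewrite lee_fin.
- exact/measurable_EFinP.
apply: ge0_le_integral => //.
- by move=> x _; rewrite lee_fin entropy_function_ge0.
- apply/measurable_EFinP; apply: measurable_funD => //.
  apply: measurable_funB; last exact: measurableT_comp.
  by apply: measurable_funM => //; exact: measurableT_comp.
- by apply: emeasurable_funD; exact/measurable_EFinP.
- by move=> x _; rewrite -EFinD lee_fin entropy_function_le.
Qed.

Lemma entropy_function_integral_le_backward : (\int[@symexp_prob R]_x
    (h x * expR (h x) - expR (h x) + 1)%:E <=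
  2740%:E * \int[@symexp_prob R]_x (backward_energy x)%:E)%E.
Proof.
have B0 : (0 <= \int[@symexp_prob R]_x (backward_energy x)%:E)%E.
  by apply: integral_ge0 => x _; rewrite lee_fin.
apply: le_trans entropy_function_integral_le _.
apply: le_trans (leeD2l _ (lee_wpmul2l _ forward_le_backward)) _.
  by rewrite lee_fin.
rewrite muleA -EFinM -ge0_muleDl ?lee_fin ?mulr_ge0//.
by rewrite -EFinD lee_wpmul2r// lee_fin; lra.
Qed.

Lemma entropy_function_integral_le_forward : (\int[@symexp_prob R]_x
    (h x * expR (h x) - expR (h x) + 1)%:E <=
  2740%:E * \int[@symexp_prob R]_x (forward_energy x)%:E)%E.
Proof.
have F0 : (0 <= \int[@symexp_prob R]_x (forward_energy x)%:E)%E.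
  by apply: integral_ge0 => x _; rewrite lee_fin.
apply: le_trans entropy_function_integral_le _.
apply: le_trans (leeD2r _ (lee_wpmul2l _ backward_le_forward)) _.
  by rewrite lee_fin.
rewrite muleA -EFinM -ge0_muleDl ?lee_fin ?mulr_ge0//.
by rewrite -EFinD lee_wpmul2r// lee_fin; lra.
Qed.

End increments.

(** * From bounded increments to the entropy *)

Theorem lemma5p2 (R : realType) (f : R -> R)
  (f_nd : {homo f : x y / x <= y})
  (f_step : forall x : R, f x - f (x - 1) <= 1 / (10 * Num.sqrt 2)) :
  (entropy_expR symexp_prob f <=
     2740%:E * \int[symexp_prob]_x ((f x - f (x - 1)) ^+ 2 * expR (f x))%:E)%E
  /\
  (entropy_expR symexp_prob f <=
     2740%:E * \int[symexp_prob]_x ((f (x + 1) - f x) ^+ 2 * expR (f x))%:E)%E.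
Proof.
pose h x := f x - f 0.
have h_nd : {homo h : x y / x <= y} by move=> x y xy; rewrite lerB// f_nd.
have h0 : h 0 = 0 by rewrite /h subrr.
have h_step x : h x - h (x - 1) <= 10^-1.
  rewrite /h (_ : _ - _ - _ = f x - f (x - 1)); last by lra.
  rewrite (le_trans (f_step x))// div1r lef_pV2 ?posrE ?mulr_gt0 ?sqrtr_gt0//.
  by rewrite ler_peMr// -[leLHS]sqrtr1 ler_wsqrtr// ler1n.
have mf : measurable_fun [set: R] f by exact: nondecreasing_measurable.
have fE x : f x = h x + f 0 by rewrite /h subrK.
have fe x : expR (f x) <= expR (f 0) * expR `|h x|.
  by rewrite -expRD ler_expR fE; have := ler_norm (h x); lra.
have i1 : (@symexp_prob R).-integrable [set: R] (EFin \o (fun x => expR (f x))).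
  apply: (@symexp_integrable_of_step _ h h_nd h0 h_step (expR (f 0))) => //.
  - exact: measurableT_comp.
  - move=> x; rewrite ger0_norm ?expR_ge0// (le_trans (fe x))//.
    by rewrite ler_wpM2l ?expR_ge0// ler_expR; have := normr_ge0 (h x); lra.
have i2 : (@symexp_prob R).-integrable [set: R]
    (EFin \o (fun x => f x * expR (f x))).
  apply: (@symexp_integrable_of_step _ h h_nd h0 h_step
    ((`|f 0| + 1) * expR (f 0))) => //.
  - by apply: measurable_funM => //; exact: measurableT_comp.
  - move=> x; rewrite normrM (ger0_norm (expR_ge0 _)).
    have ft : `|f x| <= (`|f 0| + 1) * expR (2 * `|h x|).
      rewrite fE (le_trans (ler_normD _ _))//.
      have := expR_ge1Dx (2 * `|h x|); have := normr_ge0 (h x).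
      have := normr_ge0 (f 0); nra.
    rewrite (le_trans (ler_pM (normr_ge0 _) (expR_ge0 _) ft (fe x)))//.
    rewrite mulrACA -expRD ler_wpM2l ?mulr_ge0 ?addr_ge0 ?expR_ge0//.
    by rewrite ler_expR; lra.
have mh : measurable_fun [set: R] h by exact: nondecreasing_measurable.
have scale (g : R -> R) : measurable_fun [set: R] g -> (forall x, 0 <= g x) ->
    (\int[@symexp_prob R]_x (expR (f 0) * g x)%:E =
     (expR (f 0))%:E * \int[@symexp_prob R]_x (g x)%:E)%E.
  move=> mg g0; have mgE : measurable_fun [set: R] (EFin \o g).
    exact/measurable_EFinP.
  rewrite -ge0_integralZl ?lee_fin ?expR_ge0// => x _.
  by rewrite lee_fin.
have scaled (D : R -> R) : measurable_fun [set: R] D ->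
    (\int[@symexp_prob R]_x (h x * expR (h x) - expR (h x) + 1)%:E <=
      2740%:E * \int[@symexp_prob R]_x (D x ^+ 2 * expR (h x))%R%:E ->
     entropy_expR symexp_prob f <=
      2740%:E * \int[@symexp_prob R]_x (D x ^+ 2 * expR (f x))%R%:E)%E.
  move=> mD hD; apply: le_trans (entropy_expR_le _ _ _ _ _ (f 0) i1 i2) _.
  rewrite scale; last 2 first.
  - apply: measurable_funD => //.
    apply: measurable_funB; last exact: measurableT_comp.
    by apply: measurable_funM => //; exact: measurableT_comp.
  - by move=> x; exact: entropy_function_ge0.
  under [X in (_ <= _ * X)%E]eq_integral => x _.
    rewrite fE addrC expRD mulrCA; over.
  rewrite [X in (_ <= _ * X)%E](_ : _ = (expR (f 0))%:E *
      \int[@symexp_prob R]_x (D x ^+ 2 * expR (h x))%R%:E)%E; last first.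
    apply: scale.
      apply: measurable_funM; first exact: measurable_funX.
      exact: measurableT_comp.
    by move=> x; rewrite mulr_ge0 ?sqr_ge0 ?expR_ge0.
  by rewrite muleCA lee_wpmul2l// lee_fin expR_ge0.
have hB x : h x - h (x - 1) = f x - f (x - 1) by rewrite /h; lra.
have hF x : h (x + 1) - h x = f (x + 1) - f x by rewrite /h; lra.
split; apply: scaled.
- by apply: measurable_funB => //; exact: measurable_fun_shift.
- under [X in (_ <= _ * X)%E]eq_integral do rewrite -hB.
  exact: entropy_function_integral_le_backward.
- by apply: measurable_funB => //; exact: measurable_fun_shift.
- under [X in (_ <= _ * X)%E]eq_integral do rewrite -hF.
  exact: entropy_function_integral_le_forward.
Qed.
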